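(* Let $n \geq 0$ and $s \geq 1$ be integers, and let $\mathcal F_1, \dots, \mathcal F_s \subset 2^{[n]}$ be cross-dependent. Then \[ \varrho_n(\mathcal F_1) + \dots + \varrho_n(\mathcal F_s) \leq s - 1, \] equivalently $\|\mathcal F_1\|_n + \dots + \|\mathcal F_s\|_n \leq (n+1)(s-1)$.
   Context: $[n]=\{1,\dots,n\}$ and $2^{[n]}$ is its power set. For $\mathcal F \subset 2^{[n]}$ the binomial norm is $\|\mathcal F\|_n = \sum_{F \in \mathcal F} 1\big/\binom{n}{|F|}$, and the relative measure is $\varrho_n(\mathcal F) = \|\mathcal F\|_n/(n+1)$. Families $\mathcal F_1,\dots,\mathcal F_s$ are called cross-dependent if there is no choice of $F_1 \in \mathcal F_1, \dots, F_s \in \mathcal F_s$ such that $F_1,\dots,F_s$ are pairwise disjoint. *)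

(* Defs.v *)
From mathcomp Require Import all_boot all_order all_algebra.

Set Implicit Arguments.
Unset Strict Implicit.
Unset Printing Implicit Defensive.

Import Order.TTheory GRing.Theory Num.Theory.
Local Open Scope ring_scope.

(* The ground set [n] = {1, ..., n} is represented by 'I_n = {0, ..., n-1}.   *)

Definition binomial_norm (n : nat) (F : {set {set 'I_n}}) : rat :=
  \sum_(A in F) ('C(n, #|A|)%:R)^-1.

Definition relative_measure (n : nat) (F : {set {set 'I_n}}) : rat :=
  binomial_norm F / n.+1%:R.

(* Disjointness is required for distinct indices i != j, not for distinct     *)
(* sets: a nonempty set chosen from two of the families is not disjoint from  *)
(* itself, while the empty set may be chosen from several families.           *)
Definition cross_dependent (n s : nat) (F : 'I_s -> {set {set 'I_n}}) : Prop :=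
  ~ exists A : 'I_s -> {set 'I_n},
      (forall i, A i \in F i) /\
      (forall i j, i != j -> [disjoint A i & A j]).

(* Main.v *)
Require Import Defs.
From mathcomp Require Import all_boot all_order all_algebra.
From mathcomp Require Import perm.
From mathcomp Require Import zify.

(* List the ground set in a uniformly random order p and let tau_F(p) be the
   least k such that the first k elements form a member of F (n + 1 if there is
   none). A set of size k is the k-th prefix of p with probability 1 / 'C(n, k),
   so the norm of F is the expected number of prefixes in F, which is at most
   n + 1 - E[tau_F]. It remains to show that the E[tau_{F_i}] sum to at least
   n + 1. Given F and G, delete from p its first tau_F(p) elements and append
   them at the end in reverse order; reading the result backwards recovers
   tau_F(p), so this is a bijection p -> p' of the orders. The first tau_F(p)
   elements of p and the first tau_G(p') elements of p' are disjoint with union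
   a prefix of p, so the family of disjoint unions of members of F and G has
   expected hitting time at most E[tau_F] + E[tau_G]. For cross-dependent
   families the family of all disjoint unions is empty, with hitting time
   constantly n + 1. *)

Set Implicit Arguments.
Unset Strict Implicit.
Unset Printing Implicit Defensive.

Import Order.TTheory GRing.Theory Num.Theory.
Local Open Scope ring_scope.

Lemma count_add_find (T : Type) (a : pred T) (s : seq T) :
  (count a s + find a s <= size s)%N.
Proof.
elim: s => //= x s IHs; case: (a x) => /=; last by rewrite add0n addnS ltnS.
by rewrite addn0 add1n ltnS count_size.
Qed.

(** * Prefixes of an order *)

(* A permutation p lists the ground set, the element x at position p x. *)
Definition prefix_set (n : nat) (p : {perm 'I_n}) (k : nat) : {set 'I_n} :=
  [set x | (p x < k)%N].

Lemma card_prefix_set (n : nat) (p : {perm 'I_n}) (k : nat) :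
  (k <= n)%N -> #|prefix_set p k| = k.
Proof.
move=> le_kn.
have -> : prefix_set p k = p @^-1: [set i : 'I_n | (i < k)%N].
  by apply/setP => x; rewrite !inE.
rewrite card_preimset; last exact: perm_inj.
by rewrite -sum1dep_card -(big_ord_widen n (fun=> 1%N)) // sum1_card card_ord.
Qed.

Lemma exists_prefix_set (n : nat) (A : {set 'I_n}) :
  exists p : {perm 'I_n}, prefix_set p #|A| = A.
Proof.
pose s := enum A ++ enum (~: A).
have sz_s : size s == n by rewrite size_cat -!cardE cardsC card_ord.
have uniq_s : uniq s.
  rewrite cat_uniq !enum_uniq andbT /=; apply/hasPn => x.
  by rewrite !mem_enum inE.
have perm_s : perm_eq (Tuple sz_s) (ord_tuple n).
  apply: uniq_perm; rewrite ?val_ord_tuple ?enum_uniq // => x.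
  by rewrite mem_cat !mem_enum inE orbN.
have [p def_s] := tuple_permP perm_s.
(* [p] sends an index of [s] to the element there; an order sends an element to its position, hence
   the inverse. *)
exists p^-1%g; apply/setP => x; rewrite inE.
set i := (p^-1%g) x; have -> : x = p i by rewrite /i permKV.
have sE : p i = nth x s i.
  have -> : s = Tuple sz_s by [].
  by rewrite def_s -tnth_nth tnth_mktuple tnth_ord_tuple.
rewrite sE nth_cat -cardE; case: ltnP => lt_iA.
  by rewrite -mem_enum mem_nth // -cardE.
have : nth x (enum (~: A)) (i - #|A|) \in enum (~: A).
  rewrite mem_nth // -cardE.
  have := cardsC A; rewrite card_ord; have := ltn_ord i; lia.
by rewrite mem_enum inE => /negbTE.
Qed.

Lemma card_set_ord_le (n : nat) (A : {set 'I_n}) : (#|A| <= n)%N.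
Proof. by rewrite -[X in (_ <= X)%N](card_ord n) max_card. Qed.

(** By symmetry, each of the ['C(n, k)] sets of size [k] is the [k]-th prefix of equally many
    orders. *)
Lemma card_prefix_set_eq (n : nat) (A : {set 'I_n}) :
  (#|[set p : {perm 'I_n} | prefix_set p #|A| == A]| * 'C(n, #|A|) = n`!)%N.
Proof.
set k := #|A|; have le_kn : (k <= n)%N := card_set_ord_le A.
pose c (B : {set 'I_n}) := #|[set p : {perm 'I_n} | prefix_set p k == B]|.
have preim_inj (u : {perm 'I_n}) : injective (fun C : {set 'I_n} => u @^-1: C).
  move=> C D eqCD; apply/setP => x.
  by have /setP/(_ (u^-1%g x)) := eqCD; rewrite !inE permKV.
have cE (B : {set 'I_n}) : #|B| = k -> c B = c A.
  move=> cardB; have [q qA] := exists_prefix_set A.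
  have [r rB] := exists_prefix_set B; rewrite cardB in rB.
  (* [u] maps [B] onto [A], matching equal positions of [r] and [q]. *)
  pose u : {perm 'I_n} := (r * q^-1)%g.
  have uA : u @^-1: A = B.
    by apply/setP => x; rewrite -qA -rB !inE permM permKV.
  rewrite /c -(card_preimset _ (mulgI u)); apply: eq_card => p; rewrite !inE.
  rewrite -(inj_eq (preim_inj u) (prefix_set p k)) uA; congr (_ == B).
  by apply/setP => x; rewrite !inE permM.
transitivity (\sum_(B : {set 'I_n} | #|B| == k) c B)%N.
  rewrite (eq_bigr (fun=> c A)); last by move=> B /eqP /cE.
  rewrite sum_nat_const mulnC; congr (_ * _)%N.
  by rewrite -[n in LHS]card_ord -card_draws; apply: eq_card => B; rewrite !inE.
rewrite -card_Sn -sum1_card (partition_big (fun p => prefix_set p k) (fun B => #|B| == k)) /=.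
  by apply: eq_bigr => B _; rewrite /c sum1dep_card.
by move=> p _; rewrite card_prefix_set.
Qed.

(** * Hitting times *)

Definition hitting_time (n : nat) (F : {set {set 'I_n}}) (p : {perm 'I_n}) : nat :=
  find (fun k => prefix_set p k \in F) (iota 0 n.+1).

Lemma hitting_time_le (n : nat) (F : {set {set 'I_n}}) p :
  (hitting_time F p <= n.+1)%N.
Proof. by rewrite -[n.+1](size_iota 0) find_size. Qed.

Lemma hitting_time_mem (n : nat) (F : {set {set 'I_n}}) p :
  (hitting_time F p <= n)%N -> prefix_set p (hitting_time F p) \in F.
Proof.
move=> le_n.
have hasF : has (fun k => prefix_set p k \in F) (iota 0 n.+1).
  by rewrite has_find size_iota ltnS.
by have := nth_find 0%N hasF; rewrite -/(hitting_time F p) nth_iota.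
Qed.

Lemma hitting_time_min (n : nat) (F : {set {set 'I_n}}) p k :
  (k <= n)%N -> prefix_set p k \in F -> (hitting_time F p <= k)%N.
Proof.
move=> le_kn Fk; rewrite leqNgt; apply/negP => lt_k.
by have := before_find 0%N lt_k; rewrite nth_iota // add0n Fk.
Qed.

Definition total_hitting_time (n : nat) (F : {set {set 'I_n}}) : nat :=
  (\sum_(p : {perm 'I_n}) hitting_time F p)%N.

Lemma binomial_norm_le (n : nat) (F : {set {set 'I_n}}) :
  n`!%:R * binomial_norm F + (total_hitting_time F)%:R <= (n`! * n.+1)%:R.
Proof.
have -> : n`!%:R * binomial_norm F =
    (\sum_(p : {perm 'I_n}) count (fun k => prefix_set p k \in F) (iota 0 n.+1))%:R.
  have -> : (\sum_(p : {perm 'I_n}) count (fun k => prefix_set p k \in F) (iota 0 n.+1)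
     = \sum_(A in F) #|[set p : {perm 'I_n} | prefix_set p #|A| == A]|)%N.
    under [RHS]eq_bigr do rewrite -sum1dep_card big_mkcond /=.
    rewrite exchange_big; apply: eq_bigr => p _.
    rewrite -big_mkcondr sum1dep_card.
    rewrite -sum1_count -[iota 0 n.+1]/(index_iota 0 n.+1) big_mkord sum1dep_card.
    (* Prefixes of distinct sizes [k <= n] are distinct, so counting sizes counts members of [F]. *)
    rewrite -(card_in_imset (f := fun k : 'I_n.+1 => prefix_set p k)); last first.
      move=> i j _ _ /(congr1 (fun A : {set _} => #|A|)).
      by rewrite !card_prefix_set -1?ltnS // => /val_inj.
    apply: eq_card => A; rewrite !inE; apply/imsetP/andP => [[k]|[FA /eqP eqA]].
      by rewrite inE => Fk ->; rewrite card_prefix_set -1?ltnS.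
    have leA : (#|A| < n.+1)%N by rewrite ltnS card_set_ord_le.
    by exists (Ordinal leA); rewrite ?inE /= eqA.
  rewrite /binomial_norm mulr_sumr natr_sum; apply: eq_bigr => A _.
  rewrite -(card_prefix_set_eq A) natrM mulfK // pnatr_eq0 -lt0n bin_gt0.
  exact: card_set_ord_le.
rewrite -natrD ler_nat -big_split /= -card_Sn -sum_nat_const.
by apply: leq_sum => p _; rewrite -[n.+1](size_iota 0) count_add_find.
Qed.

Lemma total_hitting_time0 (n : nat) :
  total_hitting_time (set0 : {set {set 'I_n}}) = (n`! * n.+1)%N.
Proof.
rewrite -card_Sn -sum_nat_const; apply: eq_bigr => p _.
apply/eqP; rewrite eqn_leq hitting_time_le ltnNge; apply/negP.
by move/hitting_time_mem; rewrite inE.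
Qed.

(** * The bijection of orders *)

Lemma cut_reverse_subproof (n k : nat) (j : 'I_n) :
  ((if j < k then n.-1 - j else j - k) < n)%N.
Proof. by have := ltn_ord j; case: ifP => _; lia. Qed.

(* Moves the first k positions to the end, in reverse order. *)
Definition cut_reverse_fun (n k : nat) (j : 'I_n) : 'I_n :=
  Ordinal (cut_reverse_subproof k j).

Lemma cut_reverse_inj (n k : nat) : injective (@cut_reverse_fun n k).
Proof.
move=> i j /(congr1 val) /= eq_ij; apply: val_inj => /=; move: eq_ij.
have := ltn_ord i; have := ltn_ord j; do 2 case: ifP; lia.
Qed.

Definition cut_reverse (n k : nat) : {perm 'I_n} := perm (@cut_reverse_inj n k).

Lemma val_cut_reverse (n k : nat) (j : 'I_n) :
  cut_reverse n k j = (if j < k then n.-1 - j else j - k)%N :> nat.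
Proof. by rewrite permE. Qed.

Definition restart (n : nat) (F : {set {set 'I_n}}) (p : {perm 'I_n}) :
  {perm 'I_n} := (p * cut_reverse n (hitting_time F p))%g.

(* Read backwards, [restart F p] starts like p up to the hitting time of F. *)
Lemma prefix_set_restart (n : nat) (F : {set {set 'I_n}}) p k :
  (k <= hitting_time F p)%N ->
  prefix_set p k = [set x | (n.-1 - restart F p x < k)%N].
Proof.
move=> le_k; apply/setP => x; rewrite !inE permM val_cut_reverse.
by have := ltn_ord (p x); case: ifP; lia.
Qed.

(** If two orders with the same image had different times, the prefix hit at the smaller time, read
    off the common image backwards, would start the other order too and be hit there too early. *)
Lemma restart_inj (n : nat) (F : {set {set 'I_n}}) : injective (restart F).
Proof.
have le_time p q : restart F p = restart F q ->
    (hitting_time F q <= hitting_time F p)%N.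
  move=> eq_pq; rewrite leqNgt; apply/negP => lt_pq.
  have le_n : (hitting_time F p <= n)%N.
    by rewrite -ltnS (leq_trans lt_pq) ?hitting_time_le.
  have := hitting_time_mem le_n.
  rewrite (prefix_set_restart (leqnn _)) eq_pq -(prefix_set_restart (ltnW lt_pq)).
  by move/(hitting_time_min le_n); rewrite leqNgt lt_pq.
move=> p q eq_pq; have eq_time : hitting_time F p = hitting_time F q.
  by apply/eqP; rewrite eqn_leq !le_time.
by move: eq_pq; rewrite /restart eq_time => /mulIg.
Qed.

(** * Families of disjoint unions *)

Definition disjoint_join (n : nat) (F G : {set {set 'I_n}}) : {set {set 'I_n}} :=
  [set C | [exists A in F, exists B in G, [disjoint A & B] && (C == A :|: B)]].

Lemma disjoint_joinP (n : nat) (F G : {set {set 'I_n}}) C :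
  reflect (exists A B, [/\ A \in F, B \in G, [disjoint A & B] & C = A :|: B])
          (C \in disjoint_join F G).
Proof.
rewrite inE; apply: (iffP exists_inP) => [[A FA /exists_inP[B GB]]|].
  by case/andP=> dAB /eqP->; exists A, B.
case=> A [B [FA GB dAB ->]]; exists A => //; apply/exists_inP; exists B => //.
by rewrite dAB eqxx.
Qed.

Lemma hitting_time_disjoint_join (n : nat) (F G : {set {set 'I_n}}) p :
  (hitting_time (disjoint_join F G) p
     <= hitting_time F p + hitting_time G (restart F p))%N.
Proof.
set i := hitting_time F p; set j := hitting_time G _.
have [lt_n|le_n] := ltnP n (i + j).
  exact: leq_trans (hitting_time_le _ _) lt_n.
have Fi : prefix_set p i \in F by apply: hitting_time_mem; rewrite -/i; lia.
have Gj : prefix_set (restart F p) j \in G.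
  by apply: hitting_time_mem; rewrite -/j; lia.
apply: hitting_time_min => //; apply/disjoint_joinP.
(* Since [i + j <= n], the first [j] positions stay clear of the reversed block at the end. *)
have restartE x : (restart F p x < j)%N = (i <= p x < i + j)%N.
  rewrite permM val_cut_reverse -/i.
  by have := ltn_ord (p x); case: ifP; lia.
exists (prefix_set p i), (prefix_set (restart F p) j); split=> //.
  rewrite disjoint_subset; apply/subsetP => x; rewrite !inE restartE; lia.
by apply/setP => x; rewrite !inE restartE; lia.
Qed.

Lemma total_hitting_time_disjoint_join (n : nat) (F G : {set {set 'I_n}}) :
  (total_hitting_time (disjoint_join F G)
     <= total_hitting_time F + total_hitting_time G)%N.
Proof.
(* An injection of the finite set of orders permutes it, so the sum for [G] may run over
   [restart F p]. *)
rewrite {3}/total_hitting_time (reindex_inj (restart_inj (F := F))) -big_split.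
by apply: leq_sum => p _; apply: hitting_time_disjoint_join.
Qed.

Lemma disjoint_join_family (n s : nat) (F : 'I_s -> {set {set 'I_n}}) :
  exists2 G : {set {set 'I_n}},
    (total_hitting_time G <= \sum_(i < s) total_hitting_time (F i))%N &
    forall C, C \in G -> exists A : 'I_s -> {set 'I_n},
      [/\ forall i, A i \in F i, forall i, A i \subset C &
          forall i j, i != j -> [disjoint A i & A j]].
Proof.
elim: s F => [|s IHs] F.
  (* The empty union is hit at time 0 by every order. *)
  exists [set set0] => [|C _]; last by exists (fun=> set0); split; case.
  rewrite big_ord0 leqn0 sum_nat_eq0; apply/forall_inP => p _.
  rewrite -leqn0 hitting_time_min // inE; apply/eqP/setP => x.
  by rewrite !inE.
have [G le_G GP] := IHs (fun i => F (lift ord0 i)).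
exists (disjoint_join (F ord0) G) => [|C /disjoint_joinP[A [B [FA GB dAB ->]]]].
  rewrite big_ord_recl (leq_trans (total_hitting_time_disjoint_join _ _)) //.
  by rewrite leq_add2l.
have [D [FD DB dD]] := GP B GB.
exists (fun i => oapp D A (unlift ord0 i)); split.
- by move=> i; case: unliftP => [j|] -> //=; exact: FD.
- move=> i; case: unliftP => [j|] _ /=; last exact: subsetUl.
  exact: subset_trans (DB j) (subsetUr _ _).
have dAD i : [disjoint A & D i] by exact: disjointWr (DB i) dAB.
move=> i j; case: unliftP => [i'|] ->; case: unliftP => [j'|] -> /=.
- by rewrite (inj_eq lift_inj); apply: dD.
- by rewrite disjoint_sym.
- by [].
- by [].
Qed.

Theorem theorem1p6 (n s : nat) (hs : (1 <= s)%N)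
    (F : 'I_s -> {set {set 'I_n}}) (hF : cross_dependent F) :
  \sum_(i < s) relative_measure (F i) <= s%:R - 1 /\
  \sum_(i < s) binomial_norm (F i) <= n.+1%:R * (s%:R - 1).
Proof.
suff le_norm : \sum_(i < s) binomial_norm (F i) <= n.+1%:R * (s%:R - 1).
  split=> //; rewrite /relative_measure -mulr_suml.
  by rewrite ler_pdivrMr ?ltr0n // mulrC.
have [G le_G GP] := disjoint_join_family F.
have G0 : G = set0.
  apply/setP => C; rewrite inE; apply/negP => /GP[A [FA _ dA]].
  by apply: hF; exists A.
have fact_pos : 0 < n`!%:R :> rat by rewrite ltr0n fact_gt0.
rewrite -(ler_pM2l fact_pos) mulrA -natrM mulrBr mulr1.
rewrite lerBrDr mulr_sumr -natrM.
have le_T : (n`! * n.+1)%:R <= (\sum_(i < s) total_hitting_time (F i))%:R :> rat.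
  by rewrite ler_nat -total_hitting_time0 -G0.
apply: le_trans (lerD (lexx _) le_T) _.
rewrite natr_sum -big_split /= mulnC natrM mulr_natl.
apply: le_trans (ler_sum _ (fun i _ => binomial_norm_le (F i))) _.
by rewrite sumr_const card_ord.
Qed.
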